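(* Let $G$ be a graph, let $t\geq 0$ be an integer, and let $H$ be the $t$-core of $G$. Suppose $H$ has maximum edge multiplicity at most $t+1$, and let $B$ be the underlying simple graph of the edges of $H$ of multiplicity exactly $t+1$ (i.e. the simple graph on the vertices incident to such edges, with $uv$ an edge iff $\mu_H(u,v)=t+1$). If $B$ has a full $B$-queue, then $\chi'(G)\leq \Delta(G)+t$.
   Context: A graph may have parallel edges but no loops. For vertices $x,y$, $\mu(x,y)$ is the number of edges joining $x$ and $y$; $\mu(v)=\max_u \mu(v,u)$; $d(v)$ is the degree of $v$ counting parallel edges; $\Delta(G)$ is the maximum degree. The $t$-core of $G$ is the subgraph of $G$ induced by the vertices $v$ with $d(v)+\mu(v)>\Delta(G)+t$. $\chi'(G)$ is the chromatic index. For a simple graph $B$, a $B$-queue is a sequence of distinct vertices $(u_1,\ldots,u_q)$ together with vertex subsets $(S_0,S_1,\ldots,S_q)$ such that $S_0=\emptyset$ and for all $i\in\{1,\ldots,q\}$: $S_i=N_B(u_i)\cup\{u_i\}\cup S_{i-1}$; $1\leq |S_i\setminus S_{i-1}|\leq 2$; $u_i\notin\{u_1,\ldots,u_{i-1}\}$; and $|S_i\setminus(S_{i-1}\cup\{u_i\})|\leq 1$. The $B$-queue is full if $S_q=V(B)$. *)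

(* Defs.v *)
From mathcomp Require Import all_boot.

Set Implicit Arguments.
Unset Strict Implicit.
Unset Printing Implicit Defensive.

(* Finite graphs with parallel edges and no loops: edges are objects in their
   own right, and every edge has exactly two distinct ends. *)
Record mgraph : Type := MGraph {
  vertex :> finType;
  edge : finType;
  ends : edge -> {set vertex};
  card_ends : forall e, #|ends e| = 2 }.

Arguments ends {G} e : rename.
Arguments card_ends {G} e : rename.

(* mult x x = 0, since [set x; x] is a singleton *)
Definition mult (G : mgraph) (x y : G) : nat :=
  #|[set e : edge G | ends e == [set x; y]]|.

Definition vmult (G : mgraph) (v : G) : nat := \max_(u : G) mult v u.

Definition max_mult (G : mgraph) : nat := \max_(v : G) vmult v.

Definition deg (G : mgraph) (v : G) : nat := #|[set e : edge G | v \in ends e]|.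

Definition max_deg (G : mgraph) : nat := \max_(v : G) deg v.

Section Induced.
Variables (G : mgraph) (A : {set G}).

Definition ind_vertex : finType := {x : G | x \in A}.
Definition ind_edge : finType := {e : edge G | ends e \subset A}.
Definition ind_ends (e : ind_edge) : {set ind_vertex} :=
  [set x | val x \in ends (val e)].

Lemma card_ind_ends e : #|ind_ends e| = 2.
Proof.
rewrite -(card_ends (val e)) -(card_imset _ val_inj); apply: eq_card => x.
apply/imsetP/idP => [[y + ->]|xe]; first by rewrite inE.
by exists (Sub x (subsetP (valP e) x xe)); rewrite ?inE.
Qed.

Definition induced : mgraph := MGraph card_ind_ends.

End Induced.

Definition core (G : mgraph) (t : nat) : mgraph :=
  induced [set v : G | deg v + vmult v > max_deg G + t].

Definition edge_colorable (G : mgraph) (k : nat) : bool :=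
  [exists c : {ffun edge G -> 'I_k}, forall e, forall f,
     (e != f) && ~~ [disjoint ends e & ends f] ==> (c e != c f)].

Lemma ex_edge_colorable (G : mgraph) : exists k, edge_colorable G k.
Proof.
exists #|edge G|; apply/existsP; exists [ffun e => enum_rank e].
apply/forallP => e; apply/forallP => f; apply/implyP => /andP[ef _].
by rewrite !ffunE (inj_eq enum_rank_inj).
Qed.

Definition chromatic_index (G : mgraph) : nat := ex_minn (ex_edge_colorable G).

Record sgraph : Type := SGraph {
  svertex :> finType;
  adj : rel svertex;
  adj_sym : symmetric adj;
  adj_irrefl : irreflexive adj }.

Arguments adj {B} : rename.

Definition nbr (B : sgraph) (x : B) : {set B} := [set y | adj x y].

Section MultGraph.
Variables (H : mgraph) (m : nat).

Definition mg_vertex : finType := {x : H | [exists y, mult x y == m.+1]}.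
Definition mg_adj : rel mg_vertex := fun x y => mult (val x) (val y) == m.+1.

Lemma mg_adj_sym : symmetric mg_adj.
Proof. by move=> x y; rewrite /mg_adj /mult setUC. Qed.

Lemma mg_adj_irrefl : irreflexive mg_adj.
Proof.
move=> x; apply/negP => /eqP mE.
have /card_gt0P[e] : 0 < mult (val x) (val x) by rewrite mE.
by rewrite inE setUid => /eqP eE; have := card_ends e; rewrite eE cards1.
Qed.

(* The underlying simple graph of the edges of H of multiplicity m + 1; the
   shift keeps the multiplicity positive, as irreflexivity requires. *)
Definition mult_graph : sgraph := SGraph mg_adj_sym mg_adj_irrefl.

End MultGraph.

(* [tnth u i], for i < q, is u_(i+1), so each clause below is the one of index
   i + 1 in the usual 1-based notation.  Only S 0, ..., S q are meaningful. *)
Record is_queue (B : sgraph) (q : nat) (u : q.-tuple B) (S : nat -> {set B}) :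
    Prop := IsQueue {
  queue_uniq : uniq u;
  queue_S0 : S 0 = set0;
  queue_step : forall i : 'I_q,
    S i.+1 = nbr (tnth u i) :|: [set tnth u i] :|: S i;
  queue_new : forall i : 'I_q, 1 <= #|S i.+1 :\: S i| <= 2;
  queue_fresh : forall i : 'I_q,
    tnth u i \notin [set tnth u j | j : 'I_q & j < i];
  queue_new_nbr : forall i : 'I_q,
    #|S i.+1 :\: (S i :|: [set tnth u i])| <= 1 }.

(* q = 0 is allowed: the empty queue is full exactly when B has no vertex. *)
Definition has_full_queue (B : sgraph) : Prop :=
  exists (q : nat) (u : q.-tuple B) (S : nat -> {set B}),
    is_queue u S /\ S q = [set: B].

(* Main.v *)
Require Import Defs.
From mathcomp Require Import all_boot.
From mathcomp Require Import perm zify.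

(** Put k = Delta + t and delete the vertices of G one by one: first
    u_1, ..., u_q, then the rest of the core, then all other vertices.  When w
    is deleted, every remaining neighbour y satisfies d(y) + mu(w, y) <= k in
    the current graph, except for at most one, for which k + 1 is allowed:
    outside the core this is the definition of the core; inside, the bound can
    only fail if mu(w, y) = t + 1, and a B-neighbour y of w that lies in S_i has
    already lost t + 1 edges to a deleted vertex.  Vertices are then added back
    in the reverse order, extending the colouring over the star of w by
    Schrijver's version of Vizing's argument: attach to each neighbour y a list
    of 2 mu(w, y) colours missing at y (one fewer at the exceptional vertex),
    balance by Kempe changes how many lists contain each colour until some
    colour lies in exactly one list, use it there, and induct. *)

(** * Orbits of a product of two involutions *)

Lemma iter_order_eq {T : finType} {f : T -> T} {x d} : injective f ->
  iter d f x = x -> 0 < d < 2 * order f x -> d = order f x.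
Proof.
move=> injf dx /andP[d0 d2].
have [dn|nd] := ltnP d (order f x).
  by have := findex_iter dn; rewrite dx findex0 => d00; rewrite -d00 in d0.
have mx : iter (d - order f x) f x = x.
  by rewrite -[X in iter _ f X](iter_order injf) -iterD subnK.
have mn : d - order f x < order f x by lia.
by have := findex_iter mn; rewrite mx findex0; lia.
Qed.

Section Involutions.
Variables (T : finType) (a b : T -> T) (aK : involutive a) (bK : involutive b).
Variables (x : T) (ax : a x = x).
Let p := a \o b.

Lemma involution_comp_inj : injective p.
Proof. exact: inj_comp (inv_inj aK) (inv_inj bK). Qed.

Let iter_a m y : iter m p (a (iter m p y)) = a y.
Proof. by elim: m => //= m IH; rewrite -iterS iterSr /p /= aK bK IH. Qed.

Let b_iter m : b (iter m p x) = a (iter m.+1 p x).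
Proof. by rewrite /= aK. Qed.

(** Since [a] conjugates [p] to its inverse, it sends the point m steps after [x] to the point m
    steps before [a x = x], on the same cycle. *)
Lemma fconnect_involl y : fconnect p x y -> fconnect p x (a y).
Proof.
move=> /iter_findex yE; rewrite (fconnect_sym involution_comp_inj).
by rewrite -[X in fconnect _ _ X]ax -(iter_a (findex p x y) x) yE fconnect_iter.
Qed.

Lemma fconnect_involr y : fconnect p x y -> fconnect p x (b y).
Proof.
move=> xy; rewrite -[b y]aK; apply: fconnect_involl.
exact: connect_trans xy (fconnect1 p y).
Qed.

(* On the orbit [p^m x], of length n, [a] acts as [m |-> -m] and [b] as
   [m |-> -m-1]; the only fixed index besides 0 is the m with 2m = n or
   2m + 1 = n. *)
Lemma other_fixpoint_unique y z :
    fconnect p x y -> fconnect p x z -> y != x -> z != x ->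
  (a y == y) || (b y == y) -> (a z == z) || (b z == z) -> y = z.
Proof.
pose n := order p x.
(* For n = 2m and for n = 2m + 1 alike, n - m equals [uphalf n]; this one formula recovers m from
   n. *)
have fixE u : fconnect p x u -> u != x -> (a u == u) || (b u == u) ->
    uphalf n = n - findex p x u.
  move=> xu ux fixu; set m := findex p x u.
  have mn : m < n by apply: findex_max.
  have um : iter m p x = u by apply: iter_findex.
  have m0 : 0 < m by rewrite lt0n; apply: contraNneq ux => m0; rewrite -um m0.
  have [e1|e1] : iter (2 * m) p x = x \/ iter (2 * m).+1 p x = x.
  - case/orP: fixu => /eqP; rewrite -um => fixm; [left | right].
      by rewrite mul2n -addnn iterD -{1}fixm iter_a.
    by rewrite mul2n -addnn -addSn iterD -{1}fixm b_iter iter_a.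
  - have := iter_order_eq involution_comp_inj e1; rewrite -/n; lia.
  - have := iter_order_eq involution_comp_inj e1; rewrite -/n; lia.
move=> xy xz yx zx fy fz.
have := fixE y xy yx fy; have := fixE z xz zx fz.
have := findex_max xy; have := findex_max xz; rewrite -/n => zn yn ez ey.
by rewrite -(iter_findex xy) -(iter_findex xz); congr (iter _ p x); lia.
Qed.

End Involutions.

Lemma ends_set2 {G : mgraph} {e : edge G} {x} :
  x \in ends e -> exists2 y, y != x & ends e = [set x; y].
Proof.
move=> xe; have /cards1P[y yE] : #|ends e :\ x| == 1.
  by have := cardsD1 x (ends e); rewrite xe card_ends; lia.
exists y; last by rewrite -yE setD1K.
by have := set11 y; rewrite -yE in_setD1 => /andP[].
Qed.

(** * Proper colourings, lists of missing colours and Kempe changes *)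

Section Colorings.
Variables (G : mgraph) (T : finType).
Implicit Types (c : edge G -> T) (F D : {set edge G}) (L : G -> {set T}).
Implicit Types (K : {set T}) (w x y z : G) (i j : T).

Definition proper_coloring c F := forall e f x, e \in F -> f \in F ->
  x \in ends e -> x \in ends f -> c e = c f -> e = f.

(* Each vertex carries a list of colours missing at it; the lists need not
   contain all missing colours. *)
Definition missing c F L := forall e x, e \in F -> x \in ends e -> c e \notin L x.

Definition holders L i := [set x | i \in L x].

(** The default [x] makes the map total: for a proper colouring it is an involution whose fixed
    points are the vertices without an [i]-edge in [F]. *)
Definition partner c F i x :=
  odflt x [pick y | [exists e in F, (c e == i) && (ends e == [set x; y])]].

Section Kempe.
Variables (c : edge G -> T) (F : {set edge G}) (cF : proper_coloring c F).

Lemma partnerE {e x y} :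
  e \in F -> ends e = [set x; y] -> partner c F (c e) x = y.
Proof.
move=> eF exy; rewrite /partner; case: pickP => [y' | /(_ y)] /=.
  case/exists_inP => f fF /andP[/eqP fe /eqP fxy].
  have ef : e = f.
    by apply: (cF _ _ x) => //; rewrite ?exy ?fxy ?set21.
  have : y' \in [set x; y] by rewrite -exy ef fxy set22.
  rewrite !inE => /orP[] /eqP // y'x.
  by have := card_ends f; rewrite fxy y'x setUid cards1.
by move=> /negbT/exists_inPn/(_ e eF); rewrite exy !eqxx.
Qed.

Lemma partner_id i x :
  (forall e, e \in F -> x \in ends e -> c e != i) -> partner c F i x = x.
Proof.
move=> nx; rewrite /partner; case: pickP => // y /exists_inP[e eF].
move=> /andP[ei /eqP exy]; have := nx e eF; rewrite ei exy set21.
by move=> /(_ isT).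
Qed.

Lemma partnerK i : involutive (partner c F i).
Proof.
move=> x; case: (pickP [pred e in F | (c e == i) && (x \in ends e)]) => /=.
  move=> e /and3P[eF /eqP <- /ends_set2[y _ exy]].
  by rewrite (partnerE eF exy) (partnerE (y := x) eF) // setUC.
move=> nx; rewrite !partner_id // => e eF xe; apply/negP => ei;
  by have := nx e; rewrite /= eF ei xe.
Qed.

Section Swap.
Variables (i j : T) (C : {set G}) (L : G -> {set T}).
Hypothesis closed_i : forall x, x \in C -> partner c F i x \in C.
Hypothesis closed_j : forall x, x \in C -> partner c F j x \in C.
Hypothesis cL : missing c F L.

Definition kempe_swap e :=
  if [disjoint ends e & C] then c e else tperm i j (c e).
Definition list_swap x := if x \in C then tperm i j @: L x else L x.

(** An edge with exactly one end in [C] has neither colour [i] nor [j], because [C] is closed under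
    both partner maps, and [tperm i j] fixes its colour. Hence any one end decides the new
    colour. *)
Lemma kempe_swapE e x : e \in F -> x \in ends e ->
  kempe_swap e = if x \in C then tperm i j (c e) else c e.
Proof.
move=> eF xe; rewrite /kempe_swap; have [xC | xC] := boolP (x \in C).
  by rewrite ifN //; apply/pred0Pn; exists x; rewrite /= xe.
case: ifP => // /pred0Pn[y /= /andP[ye yC]].
case: tpermP => // ce; case/negP: xC.
  have [x' x'y eE] := ends_set2 ye; have := xe; rewrite eE !inE.
  case/orP=> /eqP -> //; rewrite -(partnerE eF eE) ce; exact: closed_i.
have [x' x'y eE] := ends_set2 ye; have := xe; rewrite eE !inE.
case/orP=> /eqP -> //; rewrite -(partnerE eF eE) ce; exact: closed_j.
Qed.

Lemma proper_swap : proper_coloring kempe_swap F.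
Proof.
move=> e f x eF fF xe xf; rewrite (kempe_swapE _ x) // (kempe_swapE _ x) //.
by case: ifP => _ => [/perm_inj|]; apply: (cF _ _ _ eF fF xe xf).
Qed.

Lemma missing_swap : missing kempe_swap F list_swap.
Proof.
move=> e x eF xe; rewrite (kempe_swapE _ x) // /list_swap.
by case: ifP => _; rewrite ?(mem_imset _ _ perm_inj); apply: (cL _ _ eF xe).
Qed.

Lemma mem_list_swap h x :
  (h \in list_swap x) = (if x \in C then tperm i j h \in L x else h \in L x).
Proof.
rewrite /list_swap; case: ifP => // _.
by rewrite -{1}[h](tpermK i j) (mem_imset _ _ perm_inj).
Qed.

Lemma card_list_swap x : #|list_swap x| = #|L x|.
Proof. by rewrite /list_swap; case: ifP; rewrite ?(card_imset _ perm_inj). Qed.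

End Swap.
(** From a vertex missing [i], the cycle of the product of the two partner maps is the vertex set of
    its Kempe path, which has at most one other end. As more lists contain [i] than [j], some path
    starts at a vertex holding only [i] and does not end at one holding only [j]; its vertex set
    serves as [C]. *)
Lemma kempe_component i j L : missing c F L ->
    #|holders L j| < #|holders L i| ->
  exists C : {set G},
    [/\ forall x, x \in C -> partner c F i x \in C,
        forall x, x \in C -> partner c F j x \in C &
        #|holders L j :&: C| < #|holders L i :&: C| <= #|holders L j :&: C| + 2].
Proof.
move=> cL ltji; set a := partner c F i; set b := partner c F j.
have aK : involutive a := partnerK i; have bK : involutive b := partnerK j.
have fix_free h x : h \in L x -> partner c F h x = x.
  by move=> hx; apply: partner_id => e eF xe; apply: contraTneq hx => <-; apply: cL.
(* Vertices holding both colours count equally on both sides, so [A] is larger than [B]. *)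
pose A := holders L i :\: holders L j; pose B := holders L j :\: holders L i.
have fix_a x : x \in A -> a x = x by rewrite !inE => /andP[_ /fix_free].
have fix_b x : x \in B -> b x = x by rewrite !inE => /andP[_ /fix_free].
have injp := involution_comp_inj _ a b aK bK.
have symp := fconnect_sym injp.
have disjAB x y : x \in A -> y \in B -> x != y.
  by rewrite !inE => /andP[jx _] /andP[_ jy]; apply: contraNneq jx => ->.
have uniqAB x x' y : x \in A -> x' \in A -> y \in B ->
    fconnect (a \o b) x y -> fconnect (a \o b) x' y -> x = x'.
  move=> xA x'A yB xy x'y; apply/eqP/negPn/negP => xx'.
  have xx'c : fconnect (a \o b) x x' by rewrite (connect_trans xy) // symp.
  have := disjAB _ _ x'A yB; case/eqP.
  apply: (other_fixpoint_unique _ a b aK bK x (fix_a x xA)) => //.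
  - by rewrite eq_sym.
  - by rewrite eq_sym disjAB.
  - by rewrite fix_a ?eqxx.
  - by rewrite fix_b ?eqxx ?orbT.
(* Otherwise, sending each point of [A] to a point of [B] on its cycle would be injective by
   [uniqAB]. *)
have [x xA noB] : exists2 x, x \in A & forall y, y \in B -> ~~ fconnect (a \o b) x y.
  case: (boolP [exists x in A, [forall y in B, ~~ fconnect (a \o b) x y]]).
    by case/exists_inP=> x xA /forall_inP noB; exists x.
  move=> /exists_inPn allB.
  pose f x := odflt x [pick y in B | fconnect (a \o b) x y].
  have fP x : x \in A -> f x \in B /\ fconnect (a \o b) x (f x).
    move=> /allB/forall_inPn[y yB]; rewrite negbK => xy; rewrite /f.
    by case: pickP => [z /andP[] // | /(_ y)]; rewrite yB xy.
  have : #|A| <= #|B|.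
    rewrite -(card_in_imset (f := f) (D := A)).
      by apply/subset_leq_card/subsetP=> _ /imsetP[x xA ->]; case: (fP x xA).
    move=> x x' xA x'A ff; have [fB xf] := fP x xA; have [_ xf'] := fP x' x'A.
    by apply: (uniqAB x x' (f x)) => //; rewrite ff.
  have := cardsID (holders L i) (holders L j).
  have := cardsID (holders L j) (holders L i).
  by rewrite -/A -/B [holders L j :&: _]setIC; lia.
exists [set y | fconnect (a \o b) x y]; split.
- by move=> y; rewrite !inE; apply: fconnect_involl => //; apply: fix_a.
- by move=> y; rewrite !inE; apply: fconnect_involr => //; apply: fix_a.
set C := [set _ | _].
have Ci : holders L i :&: C :\: holders L j = A :&: C.
  by rewrite /A setIDAC.
have Cj : holders L j :&: C :\: holders L i = set0.
  apply/setP=> y; rewrite !inE; apply/negP => /and3P[iy jy yC].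
  by have := noB y; rewrite !inE iy jy yC => /(_ isT).
have x_AC : x \in A :&: C by rewrite inE xA inE connect0.
(* [C] avoids [B] and meets [A] in [x] and at most one other end, so its surplus of [i] over [j] is
   1 or 2. *)
have AC_x : #|(A :&: C) :\ x| <= 1.
  apply/card_le1_eqP=> y z; rewrite !in_setD1 !in_setI.
  move=> /and3P[yx yA yC] /and3P[zx zA zC]; rewrite !inE in yC zC.
  apply: (other_fixpoint_unique _ a b aK bK x (fix_a x xA)) => //.
    by rewrite fix_a ?eqxx.
  by rewrite fix_a ?eqxx.
have := cardsD1 x (A :&: C); rewrite x_AC -Ci in AC_x *.
have := cardsID (holders L i) (holders L j :&: C); rewrite Cj cards0.
have := cardsID (holders L j) (holders L i :&: C).
by rewrite setIAC [_ :&: _ :&: holders L i]setIAC [holders L j :&: _]setIC; lia.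
Qed.

End Kempe.

(** * Palettes and balanced lists *)

Lemma card_holders_swap i j (C : {set G}) L h :
  #|holders (list_swap i j C L) h| =
    #|holders L h :\: C| + #|holders L (tperm i j h) :&: C|.
Proof.
rewrite -[LHS](cardsID C) addnC; congr (_ + _); apply: eq_card => x;
  by rewrite !inE mem_list_swap; case: (x \in C); rewrite ?andbF.
Qed.

(** The palette [K] is a parameter because the star extension retires one colour per step. *)
Definition list_coloring c F K L := [/\ proper_coloring c F, missing c F L,
  forall e, e \in F -> c e \in K & forall x, L x \subset K].

Lemma list_coloring_swap c F K L i j (C : {set G}) :
    list_coloring c F K L -> i \in K -> j \in K ->
    (forall x, x \in C -> partner c F i x \in C) ->
    (forall x, x \in C -> partner c F j x \in C) ->
  list_coloring (kempe_swap c i j C) F K (list_swap i j C L).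
Proof.
move=> [cF cL cK LK] iK jK Ci Cj.
have tK h : (tperm i j h \in K) = (h \in K) by case: tpermP => // ->; rewrite ?iK ?jK.
split; first exact: proper_swap; first exact: missing_swap.
- by move=> e eF; rewrite /kempe_swap; case: ifP => _; rewrite ?tK; apply: cK.
- move=> x; apply/subsetP=> h; rewrite mem_list_swap.
  by case: ifP => _ /(subsetP (LK x)); rewrite ?tK.
Qed.

(** While two class sizes differ by g > 2, a Kempe change moves a surplus s of 1 or 2 from the
    larger to the smaller; the sum of squares drops by 2s(g - s) > 0, so this terminates. *)
Lemma balance c F K L : list_coloring c F K L ->
  exists c' L', [/\ list_coloring c' F K L', forall x, #|L' x| = #|L x| &
    {in K &, forall i j, #|holders L' i| <= #|holders L' j| + 2}].
Proof.
have [n] := ubnP (\sum_i #|holders L i| ^ 2).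
elim: n => // n IH in c L *; rewrite ltnS => le_n cLK.
case: (boolP [exists i in K, exists j in K, #|holders L j| + 2 < #|holders L i|]);
  last first.
  move=> /exists_inPn nij; exists c, L; split=> // i j iK jK.
  by rewrite leqNgt; move/exists_inPn: (nij i iK) => /(_ j jK).
case/exists_inP=> i iK /exists_inP[j jK ltij].
have ij : i != j by apply: contraTneq ltij => ->; lia.
have [cF cL _ _] := cLK.
have [|C [Ci Cj ltC]] := kempe_component _ _ cF i j _ cL; first by lia.
have cLK' := list_coloring_swap _ _ _ _ _ _ _ cLK iK jK Ci Cj.
have [|c' [L' [? cardL' ?]]] := IH _ _ _ cLK'; last first.
  by exists c', L'; split=> // x; rewrite cardL' card_list_swap.
apply: leq_trans le_n.
rewrite (bigD1 i) // (bigD1 j) 1?eq_sym //= [ltnRHS](bigD1 i) //.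
rewrite [X in _ < _ + X](bigD1 j) 1?eq_sym //=.
rewrite (eq_bigr (fun h => #|holders L h| ^ 2)); last first.
  move=> h /andP[hi hj]; rewrite card_holders_swap tpermD 1?eq_sym //.
  by rewrite addnC cardsID.
rewrite !card_holders_swap tpermL tpermR.
have := cardsID C (holders L i); have := cardsID C (holders L j).
nia.
Qed.

Lemma sum_holders c F K L : list_coloring c F K L ->
  \sum_(i in K) #|holders L i| = \sum_x #|L x|.
Proof.
move=> [_ _ _ LK]; under eq_bigr do rewrite -sum1_card.
under [RHS]eq_bigr do rewrite -sum1_card.
rewrite (exchange_big_dep xpredT) //=; apply: eq_bigr => x _.
apply: eq_bigl => i; rewrite inE.
by have [/(subsetP (LK x)) -> // | _] := boolP (i \in L x); rewrite andbF.
Qed.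

(* The class sizes average less than 2 and pairwise differ by at most 2, so if
   none were 1 they would all be 0 or 2, against the parity of their sum. *)
Lemma singleton_holder c F K L : list_coloring c F K L ->
    odd (\sum_x #|L x|) -> \sum_x #|L x| < 2 * #|K| ->
  exists c' L' i y, [/\ list_coloring c' F K L', forall x, #|L' x| = #|L x|,
    i \in K & holders L' i = [set y]].
Proof.
move=> /balance[c' [L' [cLK cardL' bal]]].
rewrite -(eq_bigr _ (fun x _ => cardL' x)) -(sum_holders _ _ _ _ cLK) => odd_s lt_s.
have [/exists_inP[i iK /cards1P[y yE]] | /exists_inPn no1] :=
    boolP [exists i in K, #|holders L' i| == 1].
  by exists c', L', i, y.
have [/exists_inP[i iK /eqP i0] | /exists_inPn no0] :=
    boolP [exists i in K, #|holders L' i| == 0].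
  exfalso; move: odd_s; apply/negP; rewrite -dvdn2; apply: dvdn_sum => j jK.
  have := bal j i jK iK; have := no1 j jK; rewrite i0.
  by case: #|_| => [|[|[|]]].
suff : 2 * #|K| <= \sum_(i in K) #|holders L' i| by lia.
rewrite mulnC -sum_nat_const; apply: leq_sum => i iK.
by have := no0 i iK; have := no1 i iK; lia.
Qed.

(** * Extending a colouring over a star *)

Definition star_edges D w y := [set e in D | ends e == [set w; y]].

Lemma sum_star_edges D w : (forall e, e \in D -> w \in ends e) ->
  \sum_y #|star_edges D w y| = #|D|.
Proof.
move=> Dw; rewrite -[RHS]sum1_card; under eq_bigr do rewrite -sum1_card.
rewrite (exchange_big_dep (mem D)) /=; last by move=> y e _; rewrite inE => /andP[].
apply: eq_bigr => e eD; have [y yw eE] := ends_set2 (Dw e eD).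
rewrite (bigD1 y) /=; last by rewrite inE eD eE eqxx.
rewrite big1 // => x /andP[]; rewrite inE eD /= => /eqP ex xy; case/eqP: xy.
have : y \in [set w; x] by rewrite -ex eE set22.
by rewrite !inE (negbTE yw) => /eqP.
Qed.

Lemma ex_subset_card (A : {set T}) n :
  n <= #|A| -> exists2 B : {set T}, B \subset A & #|B| = n.
Proof.
move=> nA; exists [set x in take n (enum A)].
  by apply/subsetP=> x; rewrite inE => /mem_take; rewrite mem_enum.
rewrite cardsE; have /card_uniqP -> := take_uniq n (enum_uniq A).
by rewrite size_takel // -cardE.
Qed.

Lemma ex_sublists L (m : G -> nat) : (forall x, m x <= #|L x|) ->
  exists L', forall x, L' x \subset L x /\ #|L' x| = m x.
Proof.
move=> mL; pose P x (B : {set T}) := (B \subset L x) && (#|B| == m x).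
have exP x : exists B, P x B.
  by have [B BL /eqP Bm] := ex_subset_card _ _ (mL x); exists B; rewrite /P BL.
by exists (fun x => xchoose (exP x)) => x; have /andP[? /eqP] := xchooseP (exP x).
Qed.

(* Schrijver's form of the Vizing fan argument: once a colour [i] is held by a
   single end [y], the colour class of [i] together with an edge [wy] is a
   matching, and removing it preserves the hypotheses. *)
Lemma extend_star c F K L D w z : list_coloring c F K L ->
    (forall e, e \in F -> w \notin ends e) ->
    (forall e, e \in D -> w \in ends e) -> #|D| <= #|K| ->
    (forall y, 2 * #|star_edges D w y| <= #|L y| + (y == z)) ->
  exists2 c', proper_coloring c' (F :|: D) & forall e, e \in F :|: D -> c' e \in K.
Proof.
have [n] := ubnP #|D|.
elim: n => // n IH in c F K L D z *; rewrite ltnS => Dn cLK Fw Dw DK Lz.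
have [D0 | [e0 e0D]] := set_0Vmem D.
  by have [? _ ? _] := cLK; rewrite D0 setU0; exists c.
(* If no edge of [D] joins [w] to [z], the bound at [z] is trivial and the exception may be moved to
   a neighbour of [w]. *)
wlog [e1 e1z] : z Lz / exists e, e \in star_edges D w z.
  move=> wl; have [z0 | [e ez]] := set_0Vmem (star_edges D w z); last first.
    by apply: wl Lz _; exists e.
  have [y _ e0E] := ends_set2 (Dw e0 e0D).
  apply: (wl y); last by exists e0; rewrite inE e0D e0E eqxx.
  by move=> x; have := Lz x; have [->|_] := eqVneq x z; rewrite ?z0 ?cards0 //; lia.
(* Trimming makes the total length exactly 2|D| - 1, hence odd and below 2|K|. The subtraction never
   truncates, since [e1] joins [w] to [z]. *)
have [L1 L1P] : exists L1, forall y,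
    L1 y \subset L y /\ #|L1 y| = 2 * #|star_edges D w y| - (y == z).
  by apply: ex_sublists => y; have := Lz y; lia.
have cardL1 y : #|L1 y| + (y == z) = 2 * #|star_edges D w y|.
  have [_ ->] := L1P y; have [-> | _] := eqVneq y z; last by lia.
  by have : 0 < #|star_edges D w z| by [apply/card_gt0P; exists e1]; lia.
have cL1K : list_coloring c F K L1.
  have [cF cL cK LK] := cLK; split=> // [e x eF xe | x].
    by apply: contra (subsetP (L1P x).1 _) (cL e x eF xe).
  exact: subset_trans (L1P x).1 (LK x).
have sumL1 : \sum_x #|L1 x| + 1 = 2 * #|D|.
  rewrite -(sum_star_edges _ _ Dw) big_distrr /=.
  under [RHS]eq_bigr do rewrite -cardL1.
  rewrite big_split /=; congr (_ + _).
  by rewrite (bigD1 z) //= eqxx big1 // => x /negbTE ->.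
have [||c' [L' [i [y [cL'K cardL' iK iy]]]]] := singleton_holder _ _ _ _ cL1K.
- by have := congr1 odd sumL1; rewrite addn1 mul2n odd_double /= => /negbFE.
- by lia.
have iL x : (i \in L' x) = (x == y) by rewrite -(in_set1 x) -iy inE.
have [e] : exists e, e \in star_edges D w y.
  apply/card_gt0P; have := cardL1 y; rewrite -cardL'.
  by have : 0 < #|L' y| by [apply/card_gt0P; exists i; rewrite iL eqxx]; lia.
rewrite inE => /andP[eD /eqP eE].
have [c'F c'L c'K L'K] := cL'K.
pose F' := [set f in F | c' f != i].
have [||||||c'' c''P c''K] := IH c' F' (K :\ i) (fun x => L' x :\ i) (D :\ e) z.
- by have := cardsD1 e D; rewrite eD; lia.
- split.
  + move=> f g x; rewrite !inE => /andP[fF _] /andP[gF _]; exact: c'F.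
  + by move=> f x; rewrite !inE => /andP[fF _] xf; rewrite negb_and c'L ?orbT.
  + by move=> f; rewrite !inE => /andP[fF ->]; apply: c'K.
  + by move=> x; apply: setSD.
- by move=> f; rewrite inE => /andP[fF _]; apply: Fw.
- by move=> f; rewrite !inE => /andP[_ fD]; apply: Dw.
- by have := cardsD1 e D; have := cardsD1 i K; rewrite eD iK; lia.
(* At [y] the list loses one colour while the demand drops by two; elsewhere neither changes, since
   only [L' y] contains [i]. *)
- move=> x; have := cardL1 x; rewrite -cardL'.
  have := cardsD1 i (L' x); rewrite iL.
  have -> : star_edges (D :\ e) w x = star_edges D w x :\ e.
    by apply/setP=> f; rewrite !inE andbA.
  have := cardsD1 e (star_edges D w x); rewrite inE eD eE.
  by have [-> | _] := eqVneq x y; rewrite ?eqxx /=; lia.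
pose I := e |: [set f in F | c' f == i].
have inI f : f \in F :|: D -> f \notin I -> f \in F' :|: D :\ e.
  by rewrite !inE; case: (f \in F) (f == e) (c' f == i) => [] [] []; rewrite ?andbF ?orbT.
have I_ends f x : f \in F -> c' f = i -> x \in ends f -> x \notin ends e.
  move=> fF fi xf; rewrite eE !inE; apply/norP; split.
    by apply: contraTneq xf => ->; apply: Fw.
  by rewrite -iL -fi c'L.
have properI f g x : f \in I -> g \in I -> x \in ends f -> x \in ends g -> f = g.
  rewrite !inE => /orP[/eqP-> | /andP[fF /eqP fi]] /orP[/eqP-> | /andP[gF /eqP gi]] //.
  - by move=> xe xg; case/negP: (I_ends g x gF gi xg).
  - by move=> xf xe; case/negP: (I_ends f x fF fi xf).
  - by move=> xf xg; apply: (c'F _ _ x); rewrite ?fi.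
exists (fun f => if f \in I then i else c'' f).
  move=> f g x fFD gFD xf xg; case: ifPn => fI; case: ifPn => gI.
  - by move=> _; apply: properI xf xg.
  - by have := c''K g (inI g gFD gI); rewrite !inE => /andP[/negP gi _] /esym/eqP.
  - by have := c''K f (inI f fFD fI); rewrite !inE => /andP[/negP fi _] /eqP.
  - by apply: c''P xf xg; apply: inI.
move=> f fFD; case: ifPn => // fI.
by have := c''K f (inI f fFD fI); rewrite !inE => /andP[].
Qed.

End Colorings.

(** * Deleting and restoring vertices *)

Section Deletion.
Variable G : mgraph.
Implicit Types (W A : {set G}) (w x y z u : G).

Definition within W := [set e : edge G | ends e \subset W].

Definition deg_in W y := #|[set e in within W | y \in ends e]|.

Definition colorable_on k W := exists c : edge G -> 'I_k, proper_coloring _ _ c (within W).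

Lemma chromatic_index_le k : colorable_on k setT -> chromatic_index G <= k.
Proof.
move=> [c cT]; rewrite /chromatic_index; case: ex_minnP => m _; apply.
apply/existsP; exists [ffun e => c e]; apply/'forall_'forall_implyP => e f.
rewrite !ffunE => /andP[ef /pred0Pn[x /andP[/= xe xf]]].
by apply: contraNneq ef => cef; apply/eqP/(cT e f x); rewrite ?inE ?subsetT.
Qed.

(** No edge lies within the empty set, but a colouring is a total function on edges: the degree
    bound supplies a colour as soon as there is an edge. *)
Lemma colorable_on0 k : max_deg G <= k -> colorable_on k set0.
Proof.
move=> Dk; have k_gt0 (e : edge G) : 0 < k.
  have [x xe] : exists x, x \in ends e by apply/card_gt0P; rewrite card_ends.
  apply: leq_trans Dk; apply: leq_trans (leq_bigmax x).
  by apply/card_gt0P; exists e; rewrite inE.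
exists (fun e => Ordinal (k_gt0 e)) => e f x; rewrite inE => /subset_leq_card.
by rewrite card_ends cards0.
Qed.

Lemma multC x y : mult x y = mult y x.
Proof. by rewrite /mult setUC. Qed.

Lemma mult_le_vmult x y : mult x y <= vmult x.
Proof. exact: (leq_bigmax y). Qed.

Lemma deg_le_max x : deg x <= max_deg G.
Proof. exact: (leq_bigmax x). Qed.

Lemma deg_in_le W y : deg_in W y <= deg y.
Proof. by apply/subset_leq_card/subsetP=> e; rewrite !inE => /andP[]. Qed.

Lemma deg_in_mult W u y : u \notin W -> deg_in W y + mult u y <= deg y.
Proof.
move=> uW; rewrite /deg_in /mult /deg -cardsUI.
set X := [set e in _ | _]; set Y := [set e | _ == _].
have -> : X :&: Y = set0.
  apply/setP=> e; rewrite !inE; apply/negP => /andP[/andP[/subsetP eW _] /eqP eE].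
  by case/negP: uW; apply: eW; rewrite eE set21.
rewrite cards0 addn0; apply/subset_leq_card/subsetP=> e.
by rewrite !inE => /orP[/andP[] | /eqP ->]; rewrite ?set22.
Qed.

(** If m > 0 edges within [W] join [w] to [y], at most [deg_in W y - m] colours occur at [y] before
    [w] returns, so the assumed bound leaves at least 2m missing colours, or 2m - 1 at [z]. *)
Lemma colorable_add_vertex k W w z : w \in W -> colorable_on k (W :\ w) ->
    deg w <= k ->
    (forall y, y \in W -> y != w -> deg_in W y + mult w y <= k + (y == z)) ->
  colorable_on k W.
Proof.
move=> wW [c cF] wk yk; set F := within (W :\ w) in cF.
pose D := [set e in within W | w \in ends e].
pose L y := ~: [set c e | e in F & y \in ends e].
have WE : within W = F :|: D.
  apply/setP=> e; rewrite !inE subsetD1.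
  by case: (_ \subset W); case: (w \in _).
have Fw e : e \in F -> w \notin ends e by rewrite inE subsetD1 => /andP[].
have [|||||c' c'P _] := extend_star G _ c F setT L D w z; last first.
- by exists c'; rewrite WE.
- move=> y; have [-> | [e]] := set_0Vmem (star_edges _ D w y).
    by rewrite cards0.
  rewrite !inE => /andP[/andP[eW _] /eqP eE].
  have yW : y \in W by apply: (subsetP eW); rewrite eE set22.
  have yw : y != w.
    by apply/eqP => yw; have := card_ends e; rewrite eE yw setUid cards1.
  have := yk y yW yw.
  have : #|star_edges _ D w y| <= mult w y.
    by apply/subset_leq_card/subsetP=> f; rewrite !inE => /andP[].
  pose Fy := [set e in F | y \in ends e].
  have : #|Fy| + #|star_edges _ D w y| <= deg_in W y.
    rewrite -cardsUI; have -> : Fy :&: star_edges _ D w y = set0.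
      apply/setP=> f; rewrite !inE subsetD1; apply/negP.
      by case/andP=> /andP[/andP[_ /negP nw] _] /andP[/andP[_ /nw]].
    rewrite cards0 addn0; apply/subset_leq_card/subsetP=> f.
    rewrite !inE subsetD1 => /orP[/andP[/andP[-> _] ->] //|].
    by case/andP=> /andP[-> _] /eqP ->; rewrite set22.
  have : k <= #|Fy| + #|L y|.
    rewrite -{1}[k]card_ord -(cardsC [set c f | f in F & y \in ends f]) leq_add2r.
    by apply: (leq_trans (leq_imset_card _ _)); rewrite /Fy cardsE.
  lia.
- rewrite cardsT card_ord; apply: leq_trans wk.
  by apply/subset_leq_card/subsetP=> e; rewrite !inE => /andP[].
- by move=> e; rewrite inE => /andP[].
- exact: Fw.
- split=> // e x eF xe; rewrite !inE negbK; apply/imsetP; exists e => //.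
  by rewrite inE eF.
Qed.

Lemma mult_induced A (x y : induced A) : mult x y = mult (val x) (val y).
Proof.
rewrite /mult -(card_imset _ val_inj); apply: eq_card => e; rewrite inE.
apply/imsetP/eqP => [[f] | eE].
  rewrite inE => /eqP fE ->; apply/setP=> v; apply/idP/idP => [vf | ].
    have vA := subsetP (valP f) v vf.
    have : Sub v vA \in @ends (induced A) f by rewrite inE.
    by rewrite fE !inE -!val_eqE.
  have : val x \in ends (val f) /\ val y \in ends (val f).
    have := set21 x y; have := set22 x y; rewrite -fE !inE => yf xf.
    by split.
  by case=> xf yf; rewrite !inE => /orP[] /eqP ->.
have eA : ends e \subset A.
  by apply/subsetP=> v; rewrite eE !inE => /orP[] /eqP ->; apply: valP.
exists (Sub e eA) => //; rewrite inE; apply/eqP/setP=> v.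
by rewrite !inE /= eE !inE.
Qed.

End Deletion.

(** * Degree slack in the core and along a queue *)

Lemma mem_queue {B : sgraph} {q} {u : q.-tuple B} {S} : is_queue u S ->
  forall i, i <= q -> forall x, x \in S i ->
  exists2 j : 'I_q, j < i & (x == tnth u j) || adj (tnth u j) x.
Proof.
move=> uS; elim=> [_ x | i IH iq x]; first by rewrite (queue_S0 uS) inE.
have := queue_step uS (Ordinal iq); rewrite /= => ->.
rewrite in_setU => /orP[xi | /(IH (ltnW iq))[j ji jx]]; last first.
  by exists j => //; apply: ltnW.
by exists (Ordinal iq) => //; move: xi; rewrite !inE orbC.
Qed.

Section Core.
Variables (G : mgraph) (t : nat).
Let k := max_deg G + t.
Let A := [set v : G | deg v + vmult v > k].
Let B := mult_graph (core G t) t.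
Hypothesis mult_core : max_mult (core G t) <= t.+1.
Implicit Types (W : {set G}) (w x y : G).

Definition core_vertex (v : B) : G := val (val v).

Lemma core_vertex_inj : injective core_vertex.
Proof. by move=> u v /val_inj/val_inj. Qed.

Lemma core_vertex_in v : core_vertex v \in A.
Proof. exact: valP. Qed.

Lemma adj_mult (u v : B) :
  adj u v = (mult (core_vertex u) (core_vertex v) == t.+1).
Proof. by rewrite /= /mg_adj (mult_induced _ A). Qed.

Lemma mult_core_le x y : x \in A -> y \in A -> mult x y <= t.+1.
Proof.
move=> xA yA; apply: leq_trans mult_core.
pose x' : core G t := Sub x xA; pose y' : core G t := Sub y yA.
rewrite -[mult x y](mult_induced _ A x' y').
exact: leq_trans (leq_bigmax y') (leq_bigmax x').
Qed.

Lemma ex_core_vertex x y : x \in A -> y \in A -> mult x y = t.+1 ->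
  exists v, core_vertex v = x.
Proof.
move=> xA yA xy; pose x' : core G t := Sub x xA; pose y' : core G t := Sub y yA.
have x'P : [exists z, mult x' z == t.+1].
  by apply/existsP; exists y'; rewrite (mult_induced _ A) /= xy.
by exists (Sub x' x'P).
Qed.

Lemma slack_outside_core W w y : y \notin A -> deg_in _ W y + mult w y <= k.
Proof.
rewrite inE -leqNgt; apply: leq_trans.
by rewrite leq_add ?deg_in_le // multC mult_le_vmult.
Qed.

(** Degrees are at most Delta and multiplicities in the core at most t + 1, so k = Delta + t is
    exceeded by at most one, and only at multiplicity t + 1. *)
Lemma slack_core W w y : w \in A -> y \in A ->
  deg_in _ W y + mult w y <= k \/
  mult w y = t.+1 /\ deg_in _ W y + mult w y <= k.+1.
Proof.
move=> wA yA; have := mult_core_le _ _ wA yA.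
have := deg_in_le _ W y; have := deg_le_max _ y; rewrite /k.
by have [mt | mt] := leqP (mult w y) t; [left | right]; lia.
Qed.

(** The t + 1 edges from [y] to the deleted [u] compensate for [mult w y], which is at most t +
    1. *)
Lemma slack_deleted W u w y : w \in A -> y \in A ->
  u \notin W -> mult u y = t.+1 -> deg_in _ W y + mult w y <= k.
Proof.
move=> wA yA uW uy; have := mult_core_le _ _ wA yA.
have := deg_in_mult _ W u y uW; have := deg_le_max _ y; rewrite /k uy; lia.
Qed.

Section Queue.
Variables (q : nat) (u : q.-tuple B) (S : nat -> {set B}).
Hypotheses (uS : is_queue u S) (S_full : S q = [set: B]).

Let rest i := ~: [set core_vertex (tnth u j) | j : 'I_q & j < i].

Lemma mem_rest i x :
  reflect (forall j : 'I_q, j < i -> x != core_vertex (tnth u j)) (x \in rest i).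
Proof.
rewrite inE; apply: (iffP negP) => [nx j ji | nx /imsetP[j]].
  by apply/eqP => xj; apply: nx; apply/imsetP; exists j; rewrite ?inE.
by rewrite inE => /nx /eqP.
Qed.

(** A vertex of [S i] is one of the first [i] queue vertices or a [B]-neighbour of one; being still
    in [W], it is a neighbour and has lost t + 1 edges. *)
Lemma slack_queue W i w v : i <= q -> W \subset rest i -> w \in A ->
    core_vertex v \in W -> v \in S i ->
  deg_in _ W (core_vertex v) + mult w (core_vertex v) <= k.
Proof.
move=> iq Wi wA vW vi; have [j ji vj] := mem_queue uS i iq v vi.
have vj' : v != tnth u j.
  by have /mem_rest/(_ j ji) := subsetP Wi _ vW; rewrite (inj_eq core_vertex_inj).
apply: (slack_deleted _ (core_vertex (tnth u j))) => //; first exact: core_vertex_in.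
  by apply/negP=> /(subsetP Wi)/mem_rest/(_ j ji); rewrite eqxx.
by move: vj; rewrite (negbTE vj') adj_mult => /eqP.
Qed.

Lemma colorable_after_queue W : W \subset rest q -> colorable_on G k W.
Proof.
have [n] := ubnP #|W|; elim: n => // n IH in W *; rewrite ltnS => Wn Wq.
have [-> | [w0 w0W]] := set_0Vmem W.
  by apply: colorable_on0; apply: leq_addr.
(* Core vertices go first, so a deleted [w] outside the core has no remaining neighbour in it. *)
have [w wW wA] : exists2 w, w \in W & w \in A \/ W :&: A = set0.
  have [WA | [w]] := set_0Vmem (W :&: A); first by exists w0 => //; right.
  by rewrite inE => /andP[wW wA]; exists w => //; left.
apply: (colorable_add_vertex _ _ _ w w) => //.
- apply: IH; first by have := cardsD1 w W; rewrite wW; lia.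
  exact: subset_trans (subD1set W w) Wq.
- exact: leq_trans (deg_le_max _ _) (leq_addr _ _).
move=> y yW _; apply: leq_trans (leq_addr _ _).
have [yA | /slack_outside_core//] := boolP (y \in A).
case: wA => [wA | /setP/(_ y)]; last by rewrite !in_setI in_set0 yW yA.
have [// | [wy _]] := slack_core W w y wA yA.
have [|v vE] := ex_core_vertex y w yA wA; first by rewrite multC.
by rewrite -vE; apply: (slack_queue _ q); rewrite ?vE ?S_full.
Qed.

Lemma colorable_queue_step i : i < q ->
  colorable_on G k (rest i.+1) -> colorable_on G k (rest i).
Proof.
move=> iq; set oi := Ordinal iq; set w := core_vertex (tnth u oi).
have wA : w \in A by apply: core_vertex_in.
have wi : w \in rest i.
  apply/mem_rest=> j ji; rewrite (inj_eq core_vertex_inj).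
  apply: contraNneq (queue_fresh uS oi) => ->.
  by apply/imsetP; exists j; rewrite ?inE.
have -> : rest i.+1 = rest i :\ w.
  apply/setP=> x; rewrite in_setD1; apply/mem_rest/andP => [xi | [xw /mem_rest xi] j].
    by split; [exact: (xi oi) | apply/mem_rest=> j ji; apply: xi; apply: ltnW].
  rewrite ltnS leq_eqVlt => /orP[/eqP ji | /xi //].
  by have -> : j = oi by apply: val_inj.
have new1 := queue_new_nbr uS oi.
(* The exceptional vertex is the only new element of [S i.+1] besides the queue vertex itself, with
   [w] as a dummy if there is none. *)
have [z zP] : exists z, forall v,
    v \in S i.+1 :\: (S i :|: [set tnth u oi]) -> core_vertex v = z.
  have [-> | [v vS]] := set_0Vmem (S i.+1 :\: (S i :|: [set tnth u oi])).
    by exists w => v; rewrite inE.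
  by exists (core_vertex v) => v' v'S; congr core_vertex; apply: (card_le1_eqP new1).
move=> wk; apply: (colorable_add_vertex _ _ _ w z) => //.
  exact: leq_trans (deg_le_max _ _) (leq_addr _ _).
move=> y yi yw; have [yA | /slack_outside_core le_k] := boolP (y \in A); last first.
  exact: leq_trans (le_k _ _) (leq_addr _ _).
have [le_k | [wy le_k1]] := slack_core (rest i) w y wA yA.
  exact: leq_trans le_k (leq_addr _ _).
have [|v vE] := ex_core_vertex y w yA wA; first by rewrite multC.
have [vi | vi] := boolP (v \in S i).
  apply: leq_trans (leq_addr _ _); rewrite -vE.
  by apply: (slack_queue _ i); rewrite ?vE ?(ltnW iq).
have vz : core_vertex v = z.
  apply: zP; rewrite in_setD in_setU in_set1 negb_or vi /=.
  rewrite -(inj_eq core_vertex_inj) vE yw (queue_step uS oi) !inE adj_mult vE.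
  by rewrite wy eqxx.
by rewrite -vz vE eqxx addn1.
Qed.

Lemma colorable_setT : colorable_on G k setT.
Proof.
have -> : setT = rest 0 by apply/setP=> x; rewrite in_setT; apply/esym/mem_rest.
(* Queue vertices are restored from last to first; once d reaches q, truncated subtraction makes the
   step trivial. *)
suff down d : colorable_on G k (rest (q - d)) by rewrite -(subnn q).
elim: d => [|d IH]; first by rewrite subn0; apply: colorable_after_queue.
have [dq | qd] := ltnP d q; last first.
  by have -> : q - d.+1 = q - d by lia.
by apply: colorable_queue_step; [lia | rewrite -subSn].
Qed.

End Queue.
End Core.

Theorem theorem1p5 (G : mgraph) (t : nat)
    (Hmult : max_mult (core G t) <= t.+1)
    (Hqueue : has_full_queue (mult_graph (core G t) t)) :
  chromatic_index G <= max_deg G + t.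
Proof.
have [q [u [S [uS Sq]]]] := Hqueue; apply: chromatic_index_le.
exact: colorable_setT uS Sq.
Qed.
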